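(* Let $(\mathfrak g,\langle\cdot,\cdot\rangle)$ be a metric Lie algebra of dimension $n>2$ with Ricci endomorphism $\mathrm{Ric}:\mathfrak g\to\mathfrak g$. Then $\mathfrak g$ is Bach flat if and only if it is Einstein, or its Ricci tensor satisfies one of the following conditions: (1) $\mathrm{Ric}$ is $2$-step nilpotent, i.e. $\mathrm{Ric}^2=0$; (2) $\mathrm{Ric}$ is diagonalisable with two different eigenvalues $\lambda\neq 0$ and $\mu=-\frac{n-k-1}{k-1}\lambda$, where $k\ge 2$ is the dimension of the eigenspace of $\lambda$, and the eigenspaces are non-degenerate with respect to $\langle\cdot,\cdot\rangle$. In this case, if $\mathrm{Ric}$ has a nontrivial kernel, the kernel is of dimension $1$ and non-degenerate.
   Context: A metric Lie algebra is a finite-dimensional real Lie algebra $\mathfrak g$ with a non-degenerate symmetric bilinear form $\mathrm g=\langle\cdot,\cdot\rangle$ (any signature) that is $\mathrm{ad}$-invariant: $\langle[X,Y],Z\rangle=\langle X,[Y,Z]\rangle$. It corresponds to a bi-invariant semi-Riemannian metric on a Lie group with Lie algebra $\mathfrak g$; on left-invariant fields the curvature is $\mathrm R(X,Y)Z=-\frac14[[X,Y],Z]$, $\mathrm R(X,Y,Z,V)=\langle \mathrm R(X,Y)Z,V\rangle$, and the Ricci tensor is $\mathrm{Ric}=-\frac14K$, with $K$ the Killing form of $\mathfrak g$. Via $\langle\cdot,\cdot\rangle$ the Ricci tensor is also regarded as an endomorphism of $\mathfrak g$, and $\mathrm{Ric}^2$ is the square of this endomorphism. $\mathfrak g$ is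 Einstein if $\mathrm{Ric}$ is a (possibly zero) multiple of $\mathrm g$. With $n=\dim\mathfrak g$ and scalar curvature $\rho=\mathrm{tr}(\mathrm{Ric})$, the Schouten tensor is $\mathsf P=\frac1{n-2}\left(\mathrm{Ric}-\frac{\rho}{2(n-1)}\mathrm g\right)$, the Weyl tensor is $\mathrm C_{abcd}=\mathrm R_{abcd}+\mathrm g_{ac}\mathsf P_{db}-\mathrm g_{ad}\mathsf P_{cb}+\mathrm g_{bd}\mathsf P_{ca}-\mathrm g_{bc}\mathsf P_{da}$, and, since the Cotton tensor of a bi-invariant metric vanishes, the Bach tensor is $\mathrm B_{bc}=\mathsf P^{ad}\mathrm C_{abcd}$. $\mathfrak g$ is Bach flat if $\mathrm B=0$.
   Formalization: In (2), diagonalisability, eigenvalues, eigenspaces and their non-degeneracy are taken over the complex numbers: over the reals the claim fails, e.g. for sl(2,C) as a real Lie algebra with metric the imaginary part of its complex Killing form. *)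

(* Defs.v *)
From HB Require Import structures.
From mathcomp Require Import all_boot all_order all_algebra.
From mathcomp Require Import reals.
From mathcomp.real_closed Require Import complex.

Set Implicit Arguments.
Unset Strict Implicit.
Unset Printing Implicit Defensive.

Import GRing.Theory Num.Theory passmx.
Local Open Scope ring_scope.

Section MetricLieAlgebra.
Variables (R : realType) (V : vectType R).
Variables (br : {bilinear V -> V -> V}) (g : {symmetric V}).

Record metric_lie_algebra : Prop := MetricLieAlgebra {
  lie_alternating : forall X, br X X = 0;
  lie_jacobi : forall X Y Z,
    br X (br Y Z) + br Y (br Z X) + br Z (br X Y) = 0;
  metric_nondegenerate : nondegenerate g;
  metric_ad_invariant : forall X Y Z, g (br X Y) Z = g X (br Y Z)
}.

Local Notation n := (\dim {:V}).
Local Notation e := (vbasis {:V}).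

Definition endo_trace (f : 'End(V)) : R := \tr (mxof e e f).

Definition killing (X Y : V) : R :=
  endo_trace (linfun (br X) \o linfun (br Y))%VF.

Definition gram : 'M[R]_n := \matrix_(i, j) g e`_i e`_j.

(* g^{ij}, the inverse metric *)
Definition ginv : 'M[R]_n := invmx gram.

(* The endomorphism A with g (A X) Y = h X Y, for a bilinear form h. *)
Definition raise_index (h : V -> V -> R) : 'End(V) :=
  linfun (fun X => \sum_(i < n) \sum_(j < n) (h X e`_i * ginv i j) *: e`_j).

Definition curvature (X Y Z : V) : V := - 4^-1 *: br (br X Y) Z.

Definition curvature_tensor (X Y Z W : V) : R := g (curvature X Y Z) W.

Definition ricci_tensor (X Y : V) : R := - 4^-1 * killing X Y.

Definition ricci : 'End(V) := raise_index ricci_tensor.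

Definition scalar_curvature : R := endo_trace ricci.

Definition schouten (X Y : V) : R :=
  (n%:R - 2)^-1 *
  (ricci_tensor X Y - scalar_curvature / (2 * (n%:R - 1)) * g X Y).

Definition schouten_up (a d : 'I_n) : R :=
  \sum_(i < n) \sum_(j < n) ginv a i * ginv d j * schouten e`_i e`_j.

Definition weyl (A B C D : V) : R :=
  curvature_tensor A B C D
  + g A C * schouten D B - g A D * schouten C B
  + g B D * schouten C A - g B C * schouten D A.

Definition bach (B C : V) : R :=
  \sum_(a < n) \sum_(d < n) schouten_up a d * weyl e`_a B C e`_d.

Definition bach_flat : Prop := forall X Y, bach X Y = 0.

Definition einstein : Prop :=
  exists c : R, forall X Y, ricci_tensor X Y = c * g X Y.

(* Diagonalisability and eigenvalues are taken over the complex numbers, i.e.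
   for the complex-linear extension of Ric to the complexification of V, whose
   metric is the complex-bilinear extension of g. Conjugate eigenvalues do
   occur: for sl(2,C) as a real Lie algebra with g the imaginary part of its
   complex Killing form, Ric is -1/2 times the complex structure, so Ric is not
   diagonalisable over the reals although the Bach tensor vanishes. *)
Definition ricciC : 'M[R[i]]_n := map_mx (real_complex R) (mxof e e ricci).

Definition gramC : 'M[R[i]]_n := map_mx (real_complex R) gram.

(* Vectors are coordinate rows in e; U, given by its row space, meets its
   orthogonal complement for gramC trivially. *)
Definition nondegenerateC (U : 'M[R[i]]_n) : Prop :=
  (U :&: orthomx idfun gramC U)%MS = 0.

Definition nondegenerate_subspace (U : {vspace V}) : Prop :=
  (U :&: orthov g U)%VS = 0%VS.

Definition ricci_two_eigenvalues : Prop :=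
  exists (lam mu : R[i]) (k : nat),
  [/\ [/\ lam != mu, lam != 0, (2 <= k)%N & \rank (eigenspace ricciC lam) = k],
      mu = - ((n%:R - k%:R - 1) / (k%:R - 1)) * lam,
      diagonalizable ricciC,
      (forall x, eigenvalue ricciC x = (x == lam) || (x == mu)) &
      nondegenerateC (eigenspace ricciC lam) /\
      nondegenerateC (eigenspace ricciC mu)].

End MetricLieAlgebra.

(* Main.v *)
(* By invariance of the Killing form, Ric commutes with all ad X and is
   self-adjoint, so the curvature term Ric^{ad} R_{abcd} of the Bach tensor is
   Ric^2_{bc}. With tau = tr(Ric)/(n-1), the tensor (n-2)^2 B then becomes the
   trace-free part of n (Ric^2 - tau Ric), and Bach flatness says exactly that
   Ric^2 - tau Ric is a multiple of the identity. The rest is linear algebra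
   over the complex numbers: Ric has at most two eigenvalues lam, mu, and
   tr(Ric) = (n-1)(lam + mu). If lam = mu, this forces lam = 0 and Ric^2 = 0.
   Otherwise (Ric - mu)/(lam - mu) is idempotent and its trace is the
   multiplicity k of lam, hence (k-1) mu = -(n-k-1) lam. In particular k = 1
   forces lam = 0, and mu = 0 forces k = n-1. *)
Require Import Defs.
From HB Require Import structures.
From mathcomp Require Import all_boot all_order all_algebra.
From mathcomp Require Import reals.
From mathcomp.real_closed Require Import complex.
From mathcomp Require Import ring.

Set Implicit Arguments.
Unset Strict Implicit.
Unset Printing Implicit Defensive.

Import Order.TTheory GRing.Theory Num.Theory passmx.
Local Open Scope ring_scope.

(* With P = L R the rank factorisation, the hypothesis says R L = a. *)
Lemma mxtrace_quasi_idempotent (F : fieldType) n (P : 'M[F]_n) (a : F) :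
  P *m P = a *: P -> \tr P = a * (\rank P)%:R.
Proof.
move=> PP.
have [L [R [Lfull Rfree LR]]] : exists (L : 'M_(n, \rank P)) (R : 'M_(_, n)),
    [/\ row_full L, row_free R & L *m R = P].
  exists (col_base P), (row_base P); split; last exact: mulmx_base.
    exact: col_base_full.
  exact: row_base_free.
have RL : R *m L = a%:M.
  apply: (row_free_inj Rfree); apply: (row_full_inj Lfull).
  by rewrite mul_scalar_mx -scalemxAr !mulmxA LR -mulmxA LR.
by rewrite -[in LHS]LR mxtrace_mulC RL mxtrace_scalar mulr_natr.
Qed.

(** * Matrices annihilated by two distinct linear factors *)

Section TwoEigenvalues.
Variables (F : fieldType) (n : nat) (N : 'M[F]_n) (lam mu : F).
Hypothesis lam_neq_mu : lam != mu.
Hypothesis annN : (N - lam%:M) *m (N - mu%:M) = 0.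

Lemma quadratic_annihilatorC : (N - mu%:M) *m (N - lam%:M) = 0.
Proof.
rewrite -annN !mulmxBl !mulmxBr !mul_mx_scalar !mul_scalar_mx !scale_scalar_mx.
by rewrite (mulrC lam); apply/matrixP => i j; rewrite !mxE; ring.
Qed.

(** The projection onto the [lam]-eigenspace along the [mu]-eigenspace, acting on rows. *)
Let P := (lam - mu)^-1 *: (N - mu%:M).

Let d_neq0 : lam - mu != 0. Proof. by rewrite subr_eq0. Qed.

Lemma eigenspace_eq_proj : (eigenspace N lam :=: P)%MS.
Proof.
apply/eqmxP/andP; split; last first.
  by apply/sub_kermxP; rewrite -scalemxAl quadratic_annihilatorC scaler0.
apply/row_subP => i; set v := row i _.
have /eigenspaceP vN : (v <= eigenspace N lam)%MS by apply: row_sub.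
suff -> : v = v *m P by apply: submxMl.
rewrite /P -scalemxAr mulmxBr vN mul_mx_scalar -scalerBl scalerA.
by rewrite mulVf // scale1r.
Qed.

(** [P] is idempotent with row space the [lam]-eigenspace, so the multiplicity of [lam] is the trace
    of [P]. *)
Lemma rank_eigenspace_two :
  (\rank (eigenspace N lam))%:R * (lam - mu) = \tr N - n%:R * mu.
Proof.
have -> : \rank (eigenspace N lam) = \rank P.
  by rewrite eigenspace_eq_proj.
have PP : P *m P = 1 *: P.
  rewrite scale1r /P -scalemxAl -scalemxAr; congr (_ *: _).
  have {1}-> : N - mu%:M = N - lam%:M + (lam - mu)%:M.
    by rewrite raddfB /= addrA subrK.
  by rewrite mulmxDl annN add0r mul_scalar_mx scalerA mulVf // scale1r.
rewrite -[X in X * _]mul1r -(mxtrace_quasi_idempotent PP).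
rewrite /P mxtraceZ linearB /= mxtrace_scalar -[mu *+ n]mulr_natl.
by rewrite mulrAC mulVf // mul1r.
Qed.

Lemma eigenspace_two_full :
  (eigenspace N lam + eigenspace N mu :=: 1%:M)%MS.
Proof.
apply/eqmxP; rewrite submx1 /=.
(* The two factors differ by a nonzero scalar, and the rows of each lie in the eigenspace killed by
   the other. *)
have -> : 1%:M = (lam - mu)^-1 *: ((N - mu%:M) - (N - lam%:M)) :> 'M[F]_n.
  rewrite opprB [X in _ *: X]addrC addrA subrK -raddfB /=.
  by rewrite scale_scalar_mx mulVf.
rewrite scalemx_sub // addmx_sub_adds //; apply/sub_kermxP.
  exact: quadratic_annihilatorC.
by rewrite mulNmx annN oppr0.
Qed.

Lemma diagonalizable_two : diagonalizable N.
Proof.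
apply/diagonalizablePeigen; exists [:: lam; mu].
  by rewrite /= inE lam_neq_mu.
rewrite big_cons big_seq1; exact: eigenspace_two_full.
Qed.

Lemma eigenvalue_two x : eigenvalue N x -> (x == lam) || (x == mu).
Proof.
move=> /eigenvalueP[v vN v0].
have vB y : v *m (N - y%:M) = (x - y) *: v.
  by rewrite mulmxBr vN mul_mx_scalar scalerBl.
have: v *m ((N - lam%:M) *m (N - mu%:M)) = 0 by rewrite annN mulmx0.
rewrite mulmxA vB -scalemxAl vB scalerA => /eqP.
by rewrite scaler_eq0 (negPf v0) orbF mulf_eq0 !subr_eq0.
Qed.

(** For [N] self-adjoint with respect to [G] the two eigenspaces are orthogonal. As they span, a
    [lam]-eigenvector orthogonal to its own eigenspace is orthogonal to everything. *)
Lemma nondegenerate_eigenspace_two (G : 'M[F]_n) :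
  N *m G = G *m N^T -> row_free G ->
  (eigenspace N lam :&: orthomx idfun G (eigenspace N lam))%MS = 0.
Proof.
move=> NG Gfree; apply/eqP; rewrite -submx0.
apply/rV_subP => v; rewrite sub_capmx => /andP[vE].
move/sub_kermxP; rewrite mulmxA map_mx_id // => vGlam.
move/eigenspaceP: (vE) => vN.
have vGmu : v *m G *m (eigenspace N mu)^T = 0.
  set E := eigenspace N mu.
  have EN : E *m N = mu *: E.
    by have/sub_kermxP := submx_refl E; rewrite mulmxBr mul_mx_scalar
      => /eqP; rewrite subr_eq0 => /eqP.
  have : v *m (N *m G) *m E^T = v *m (G *m N^T) *m E^T by rewrite NG.
  rewrite !mulmxA vN -(mulmxA (v *m G)) -trmx_mul EN linearZ /= -!scalemxAl.
  rewrite -scalemxAr => /eqP; rewrite -subr_eq0 -scalerBl scaler_eq0.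
  by rewrite subr_eq0 (negPf lam_neq_mu) => /eqP.
rewrite submx0; apply/eqP/(row_free_inj Gfree); rewrite mul0mx.
apply: trmx_inj; rewrite trmx0.
suff: (1%:M <= kermx (v *m G)^T)%MS by move/sub_kermxP; rewrite mul1mx.
rewrite -eigenspace_two_full addsmx_sub; apply/andP; split.
  by apply/sub_kermxP; rewrite -{1}[eigenspace _ _]trmxK -trmx_mul vGlam trmx0.
by apply/sub_kermxP; rewrite -{1}[eigenspace _ _]trmxK -trmx_mul vGmu trmx0.
Qed.

End TwoEigenvalues.

Lemma diagonalizable_two_ann (F : fieldType) n (N : 'M[F]_n) lam mu :
  diagonalizable N ->
  (forall x, eigenvalue N x -> (x == lam) || (x == mu)) ->
  (N - lam%:M) *m (N - mu%:M) = 0.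
Proof.
move=> /diagonalizablePeigen[rs _ rs1] eigN.
suff: (1%:M <= kermx ((N - lam%:M) *m (N - mu%:M)))%MS.
  by move/sub_kermxP; rewrite mul1mx.
rewrite -rs1 big_seq; elim/big_ind: _ => [|A B hA hB|r _]; first exact: sub0mx.
  by rewrite addsmx_sub hA.
(* The list [rs] may contain values that are not eigenvalues; their eigenspaces are zero. *)
have [->|E0] := eqVneq (eigenspace N r) 0; first exact: sub0mx.
apply/row_subP => i; apply/sub_kermxP; set v := row i _.
have /eigenspaceP vN : (v <= eigenspace N r)%MS by apply: row_sub.
have vB y : v *m (N - y%:M) = (r - y) *: v.
  by rewrite mulmxBr vN mul_mx_scalar scalerBl.
rewrite mulmxA vB -scalemxAl vB scalerA.
by case/orP: (eigN r E0) => /eqP->; rewrite subrr ?mul0r ?mulr0 scale0r.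
Qed.

(** * Quadratic matrix equations with a prescribed trace *)

(* The trace condition tr N = (n - 1)(lam + mu) rules out nonzero double roots
   and fixes the multiplicities in terms of lam and mu. *)
Section QuadraticTrace.
Variables (C : numFieldType) (n : nat) (N : 'M[C]_n).
Hypothesis n_gt2 : (2 < n)%N.

Let n2R : (2 : C) < n%:R. Proof. by rewrite ltr_nat. Qed.

Let n2_neq0 : n%:R - 2 != 0 :> C. Proof. by rewrite subr_eq0 gt_eqF. Qed.

Lemma double_root_sqr0 (lam : C) :
  (N - lam%:M) *m (N - lam%:M) = 0 ->
  \tr N = (n%:R - 1) * (lam + lam) -> N *m N = 0.
Proof.
move=> sq0 trN.
have: \tr (N - lam%:M) = 0.
  (* A matrix of square zero is quasi-idempotent with factor 0, hence has trace 0. *)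
  by rewrite (@mxtrace_quasi_idempotent _ _ _ 0) ?mul0r // scale0r.
rewrite raddfB /= mxtrace_scalar trN -mulr_natl => trB.
have /eqP : (n%:R - 2) * lam = 0 by rewrite -trB; ring.
rewrite mulf_eq0 (negPf n2_neq0) /= => /eqP lam0.
by move: sq0; rewrite lam0 raddf0 subr0.
Qed.

Lemma two_roots_multiplicity (lam mu : C) :
  lam != mu -> (N - lam%:M) *m (N - mu%:M) = 0 ->
  \tr N = (n%:R - 1) * (lam + mu) -> lam != 0 ->
  eigenspace N lam != 0 ->
  let k := \rank (eigenspace N lam) in
  (2 <= k)%N /\ mu = - ((n%:R - k%:R - 1) / (k%:R - 1)) * lam.
Proof.
move=> lm annN trN lam0 E0 k.
have := rank_eigenspace_two lm annN; rewrite -/k trN => rk.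
(* For [k = 1] the rank formula reads lam - mu = (n-1) lam - mu, that is (n-2) lam = 0. *)
have k1 : k != 1%N.
  apply/eqP => k1; move: rk; rewrite k1 => rk.
  have /eqP : (n%:R - 2) * lam = 0.
    apply: (@addIr _ (1 * (lam - mu))); rewrite {2}rk; ring.
  by rewrite mulf_eq0 (negPf n2_neq0) (negPf lam0).
have k0 : k != 0%N by rewrite mxrank_eq0.
have k2 : (2 <= k)%N by case: (k) k0 k1 => [|[|]].
split=> //.
have k1R : k%:R - 1 != 0 :> C by rewrite subr_eq0 -[1]/(1%:R) eqr_nat.
apply: (mulfI k1R); rewrite mulrA mulrN mulrCA mulfV // mulr1.
apply/eqP; rewrite -subr_eq0; apply/eqP.
have : k%:R * (lam - mu) - ((n%:R - 1) * (lam + mu) - n%:R * mu) = 0.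
  by rewrite rk subrr.
by move=> e; rewrite -oppr0 -e; ring.
Qed.

End QuadraticTrace.

Section Quadratic.
Variables (C : numClosedFieldType) (n : nat) (N : 'M[C]_n).
Hypothesis n_gt2 : (2 < n)%N.

Lemma quadratic_trace_cases (t c : C) :
  \tr N = (n%:R - 1) * t -> N *m N - t *: N = c%:M ->
  [\/ exists a, N = a%:M, N *m N = 0 |
   exists lam mu,
     [/\ lam != mu, lam != 0, (N - lam%:M) *m (N - mu%:M) = 0,
         eigenspace N lam != 0 & eigenspace N mu != 0]
     /\ \tr N = (n%:R - 1) * (lam + mu)].
Proof.
move=> trN quadN.
(* The roots of x^2 - t x - c; afterwards only their sum t and product -c matter. *)
pose s := sqrtC (t ^+ 2 + 4 * c).
have s2 : s ^+ 2 = t ^+ 2 + 4 * c by rewrite sqrtCK.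
pose lam := (t + s) / 2; pose mu := (t - s) / 2.
have sumE : lam + mu = t by rewrite /lam /mu; field.
have prodE : lam * mu = - c.
  have -> : c = (s ^+ 2 - t ^+ 2) / 4 by rewrite s2; field.
  by rewrite /lam /mu; field.
move: (lam) (mu) sumE prodE => {s s2 lam mu} a b sumE prodE.
have annE : (N - a%:M) *m (N - b%:M) = 0.
  rewrite mulmxBl !mulmxBr !mul_mx_scalar !mul_scalar_mx scale_scalar_mx.
  rewrite (mulrC b) prodE.
  rewrite rmorphN /= -quadN -sumE scalerDl.
  by apply/matrixP => i j; rewrite !mxE; ring.
have [ab|ab] := eqVneq a b.
  apply: Or32; apply: (double_root_sqr0 n_gt2 (lam := a)).
    by rewrite {2}ab.
  by rewrite {2}ab sumE.
(* If [x] is not an eigenvalue, N - x is invertible and cancels. *)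
have scal x y : (N - x%:M) *m (N - y%:M) = 0 -> eigenspace N x = 0 -> N = y%:M.
  move=> ann E0; apply/eqP; rewrite -subr_eq0; apply/eqP.
  have: row_free (N - x%:M) by rewrite -kermx_eq0; apply/eqP.
  move=> fr; have: row_full (N - x%:M) by rewrite row_full_unit -row_free_unit.
  by move/row_full_inj; apply; rewrite ann mulmx0.
have annE' := quadratic_annihilatorC annE.
have [Ea|Ea] := eqVneq (eigenspace N a) 0.
  by apply: Or31; exists b; apply: scal Ea.
have [Eb|Eb] := eqVneq (eigenspace N b) 0.
  by apply: Or31; exists a; apply: scal Eb.
(* Distinct roots are not both zero; a nonzero one is taken as [lam]. *)
apply: Or33; have [a0|a0] := eqVneq a 0.
  exists b, a; split; last by rewrite (addrC b) sumE.
  by split=> //; [rewrite eq_sym | rewrite -a0 eq_sym].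
by exists a, b; split=> //; rewrite sumE.
Qed.

End Quadratic.

(** Brings scalar matrices back from the complex to the real numbers. The scalar is read off at
    entry (0,0), whence [0 < n]. *)
Lemma map_mx_scalar_inv (F L : fieldType) (f : {rmorphism F -> L}) n
    (B : 'M[F]_n) (a : L) :
  (0 < n)%N -> map_mx f B = a%:M -> exists c, B = c%:M.
Proof.
case: n B => // n B _ fB; exists (B 0 0); apply: (@map_mx_inj _ _ f).
by rewrite map_scalar_mx fB; congr _%:M; move/matrixP/(_ 0 0): fB; rewrite !mxE.
Qed.

(** Evaluates [linfun] on a bare function with a proof of linearity, as arises from
    [raise_index]. *)
Lemma linfun_linearE (F : fieldType) (U W : vectType F) (f : U -> W) :
  linear f -> linfun f =1 f.
Proof.
move=> lin x; pose L := GRing.isLinear.Build F U W *:%R f lin.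
pose f' : {linear U -> W} := HB.pack f L; exact: (lfunE f').
Qed.

(** * The metric and its dual basis *)

Section MetricLie.
Variables (R : realType) (V : vectType R).
Variables (br : {bilinear V -> V -> V}) (g : {symmetric V}).
Hypothesis hg : metric_lie_algebra br g.

Local Notation n := (\dim {:V}).
Local Notation e := (vbasis {:V}).
Local Notation tr := (@endo_trace R V).
Local Notation A := (ricci br g).
Local Notation M := (mxof e e A).

Let ebasis : basis_of {:V} e := vbasisP _.

Lemma metricC x y : g x y = g y x.
Proof. by rewrite hermC /= expr0 mul1r. Qed.

Lemma metricPr a x y z : g x (a *: y + z) = a * g x y + g x z.
Proof. by rewrite linearDr linearZr_LR. Qed.

Lemma metricPl a x y z : g (a *: y + z) x = a * g y x + g z x.
Proof. by rewrite !(metricC _ x) metricPr. Qed.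

Lemma metricZl a x y : g (a *: x) y = a * g x y.
Proof. by rewrite !(metricC _ y) linearZr_LR. Qed.

Lemma metricDl x y z : g (x + y) z = g x z + g y z.
Proof. by rewrite !(metricC _ z) linearDr. Qed.

Lemma metricBl x y z : g (x - y) z = g x z - g y z.
Proof. by rewrite !(metricC _ z) linearBr. Qed.

Lemma metric_sumr I (r : seq I) (c : I -> R) (v : I -> V) x :
  g x (\sum_(i <- r) c i *: v i) = \sum_(i <- r) c i * g x (v i).
Proof. by rewrite linear_sumr; apply: eq_bigr => i _; rewrite linearZr_LR. Qed.

Lemma metric_suml I (r : seq I) (c : I -> R) (v : I -> V) x :
  g (\sum_(i <- r) c i *: v i) x = \sum_(i <- r) c i * g (v i) x.
Proof.
by rewrite metricC metric_sumr; apply: eq_bigr => i _; rewrite metricC.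
Qed.

Lemma metric_inj x y : (forall z, g x z = g y z) -> x = y.
Proof.
move=> gxy; apply/eqP; rewrite -subr_eq0 -memv0.
have /eqP <- := metric_nondegenerate hg.
by apply/mem_orthovP => z _; rewrite metricC linearBr /= !(metricC z) gxy subrr.
Qed.

Lemma trmx_gram : (gram g)^T = gram g.
Proof. by apply/matrixP => i j; rewrite !mxE metricC. Qed.

Lemma metric_vecof u v :
  g (vecof e u) (vecof e v) = (u *m gram g *m v^T) 0 0.
Proof.
rewrite metric_sumr mxE; apply: eq_bigr => j _; rewrite mulrC metric_suml !mxE.
by congr (_ * _); apply: eq_bigr => i _; rewrite mxE.
Qed.

Lemma gram_row_free : row_free (gram g).
Proof.
rewrite -kermx_eq0; apply/eqP/row_matrixP => i; rewrite row0.
set v := row i _; have vG : v *m gram g = 0 by apply/sub_kermxP/row_sub.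
apply/eqP; rewrite -(vecof_eq0 ebasis); apply/eqP/metric_inj => z.
by rewrite linear0l -(rVofK ebasis z) metric_vecof vG mul0mx mxE.
Qed.

(** Absorbs the inverse metric, so that index contractions become sums over dual pairs of basis
    vectors. *)
Definition dual_basis (a : 'I_n) : V := \sum_(i < n) ginv g a i *: e`_i.

Local Notation d := dual_basis.

Lemma metric_basis_dual (i a : 'I_n) : g e`_i (d a) = (i == a)%:R.
Proof.
have : ginv g *m gram g = 1%:M.
  by rewrite mulVmx // -row_free_unit gram_row_free.
move/matrixP/(_ a i); rewrite !mxE eq_sym => <-.
by rewrite metric_sumr; apply: eq_bigr => k _; rewrite mxE metricC.
Qed.

Lemma coord_dual a v : coord e a v = g v (d a).
Proof.
rewrite {2}(coord_basis ebasis (memvf v)) metric_suml (bigD1 a) //=.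
rewrite metric_basis_dual eqxx mulr1 big1 ?addr0 // => i /negPf ia.
by rewrite metric_basis_dual ia mulr0.
Qed.

Lemma basis_expansion v : v = \sum_(a < n) g v (d a) *: e`_a.
Proof.
rewrite {1}(coord_basis ebasis (memvf v)).
by apply: eq_bigr => a _; rewrite coord_dual.
Qed.

Lemma dual_expansion v : v = \sum_(a < n) g v e`_a *: d a.
Proof.
apply: metric_inj => z; rewrite metric_suml {1}(basis_expansion z) metric_sumr.
by apply: eq_bigr => a _; rewrite mulrC (metricC z).
Qed.

Lemma dual_pairing x y : \sum_(a < n) g e`_a x * g (d a) y = g x y.
Proof.
rewrite {2}(dual_expansion x) metric_suml.
by apply: eq_bigr => a _; rewrite (metricC _ x).
Qed.

(** * Traces of endomorphisms *)

Lemma endo_traceE (f : 'End(V)) : tr f = \sum_(a < n) g (f e`_a) (d a).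
Proof.
by apply: eq_bigr => a _; rewrite mxE /= !mxE vecof_delta coord_dual.
Qed.

Lemma endo_traceC (f h : 'End(V)) : tr (f \o h)%VF = tr (h \o f)%VF.
Proof. by rewrite /endo_trace !(mxof_comp _ _ ebasis) mxtrace_mulC. Qed.

Lemma eq_endo_trace (f h : 'End(V)) : f =1 h -> tr f = tr h.
Proof.
by move=> fh; rewrite !endo_traceE; apply: eq_bigr => a _; rewrite fh.
Qed.

Lemma endo_traceP a (f h k : 'End(V)) :
  (forall x, k x = a *: f x + h x) -> tr k = a * tr f + tr h.
Proof.
move=> kE; rewrite !endo_traceE mulr_sumr -big_split; apply: eq_bigr => i _.
by rewrite kE metricPl.
Qed.

Lemma endo_trace_id : tr \1%VF = n%:R.
Proof.
rewrite endo_traceE (eq_bigr (fun _ => 1)) => [|a _]; last first.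
  by rewrite id_lfunE metric_basis_dual eqxx.
by rewrite sumr_const card_ord.
Qed.

(** * The bracket, the Killing form and the Ricci endomorphism *)

Lemma brPl a x y z : br (a *: y + z) x = a *: br y x + br z x.
Proof. by rewrite linearDl linearZl_LR. Qed.

Lemma brC x y : br x y = - br y x.
Proof.
apply/eqP; rewrite -addr_eq0; apply/eqP.
have := lie_alternating hg (x + y).
by rewrite linearDl !linearDr /= !(lie_alternating hg) addr0 add0r.
Qed.

Local Notation ad x := (linfun (br x)).

Lemma adE x y : ad x y = br x y.
Proof. by rewrite lfunE. Qed.

Lemma ad_br x y z : br (br x y) z = br x (br y z) - br y (br x z).
Proof.
have := lie_jacobi hg x y z; rewrite (brC z (br x y)) (brC z x) linearNr.
by move/eqP; rewrite subr_eq0 => /eqP <-.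
Qed.

Lemma killingC x y : killing br x y = killing br y x.
Proof. exact: endo_traceC. Qed.

Lemma killingPl a x y z :
  killing br (a *: x + y) z = a * killing br x z + killing br y z.
Proof. by apply: endo_traceP => v; rewrite !comp_lfunE !adE brPl. Qed.

Lemma killing_sumr I (r : seq I) (c : I -> R) (v : I -> V) x :
  killing br x (\sum_(i <- r) c i *: v i) =
  \sum_(i <- r) c i * killing br x (v i).
Proof.
rewrite killingC; elim/big_rec2: _ => [|i t u _ <-]; last first.
  by rewrite killingPl (killingC _ x).
(* The empty sum: linearity with coefficient -1 at zero vectors forces the value 0. *)
by have := killingPl (-1) 0 0 x; rewrite scaler0 addr0 mulN1r addNr.
Qed.

(** Expanding ad of a bracket as a commutator, the two sides differ only in tr (ad y ad x ad z)
    against tr (ad x ad z ad y), equal by cyclicity. *)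
Lemma killing_invariant x y z : killing br (br x y) z = killing br x (br y z).
Proof.
have k1 : killing br (br x y) z =
    -1 * tr (ad y \o (ad x \o ad z))%VF + tr (ad x \o (ad y \o ad z))%VF.
  apply: endo_traceP => v.
  by rewrite !comp_lfunE !adE ad_br scaleN1r addrC.
have k2 : killing br x (br y z) =
    -1 * tr (ad x \o (ad z \o ad y))%VF + tr (ad x \o (ad y \o ad z))%VF.
  apply: endo_traceP => v.
  by rewrite !comp_lfunE !adE ad_br linearBr scaleN1r addrC.
rewrite k1 k2; congr (_ * _ + _).
by rewrite endo_traceC; congr tr; rewrite comp_lfunA.
Qed.

Lemma ricciE x y : g (A x) y = ricci_tensor br x y.
Proof.
(* The inner sum of [raise_index] is the dual basis vector [d i]. *)
have A_E : A x = \sum_(i < n) ricci_tensor br x e`_i *: d i.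
  rewrite /A linfun_linearE.
    apply: eq_bigr => i _; rewrite scaler_sumr.
    by apply: eq_bigr => j _; rewrite scalerA.
  move=> a u v; rewrite scaler_sumr -big_split; apply: eq_bigr => i _ /=.
  rewrite scaler_sumr -big_split; apply: eq_bigr => j _ /=.
  by rewrite /ricci_tensor killingPl scalerA -scalerDl; congr (_ *: _); ring.
rewrite A_E metric_suml {2}(basis_expansion y) /ricci_tensor killing_sumr.
by rewrite mulr_sumr; apply: eq_bigr => i _; rewrite (metricC (d i)); ring.
Qed.

Lemma ricci_adjoint x y : g (A x) y = g x (A y).
Proof. by rewrite ricciE (metricC x) ricciE /ricci_tensor killingC. Qed.

Lemma ricci_br x y : A (br x y) = br (A x) y.
Proof.
apply: metric_inj => z; rewrite (metric_ad_invariant hg) !ricciE.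
by rewrite /ricci_tensor killing_invariant.
Qed.

Lemma ricci_br_r x y : A (br x y) = br x (A y).
Proof. by rewrite (brC x y) linearN /= ricci_br (brC x) . Qed.

(** * The Schouten endomorphism and the contractions in the Bach tensor *)

Local Notation rho := (scalar_curvature br g).
Local Notation m := (n%:R - 2 : R).
Local Notation sigma := (rho / (2 * (n%:R - 1))).

Definition schouten_endo : 'End(V) := m^-1 *: (A - sigma *: \1%VF).

Local Notation S := schouten_endo.

Lemma schouten_endoE x : S x = m^-1 *: (A x - sigma *: x).
Proof. by rewrite scale_lfunE add_lfunE opp_lfunE scale_lfunE id_lfunE. Qed.

Lemma schoutenE x y : schouten br g x y = g (S x) y.
Proof.
by rewrite schouten_endoE metricZl metricBl metricZl ricciE.
Qed.

Lemma schouten_adjoint x y : g (S x) y = g x (S y).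
Proof.
rewrite -schoutenE (metricC x) -schoutenE /schouten -!ricciE ricci_adjoint.
by rewrite !(metricC x).
Qed.

(** The raised components are g (S (d a)) (d b), the coordinates of [S (d a)]; the sum over [b]
    reassembles this vector in the second slot of [h]. *)
Lemma schouten_up_contract (h : V -> V -> R) :
  (forall x, scalar (h x)) ->
  \sum_(a < n) \sum_(b < n) schouten_up br g a b * h e`_a e`_b =
  \sum_(a < n) h e`_a (S (d a)).
Proof.
move=> hlin; apply: eq_bigr => a _.
have h_sum (I : Type) (r : seq I) c (v : I -> V) x :
    h x (\sum_(i <- r) c i *: v i) = \sum_(i <- r) c i * h x (v i).
  elim/big_rec2: _ => [|i t u _ <-]; last by rewrite hlin.
  by have := hlin x (-1) 0 0; rewrite scaler0 addr0 mulN1r addNr.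
rewrite [S (d a)]basis_expansion h_sum; apply: eq_bigr => b _.
congr (_ * _); rewrite schouten_adjoint {1}/dual_basis metric_suml.
apply: eq_bigr => i _; rewrite -schouten_adjoint metric_sumr mulr_sumr.
by apply: eq_bigr => j _; rewrite schoutenE mulrA.
Qed.

Lemma endo_traceD (f h : 'End(V)) : tr (f + h) = tr f + tr h.
Proof. by rewrite /endo_trace !linearD. Qed.

Lemma endo_traceZ a (f : 'End(V)) : tr (a *: f) = a * tr f.
Proof. by rewrite /endo_trace linearZ mxtraceZ. Qed.

Lemma schouten_trace_ginv : tr S = m^-1 * (rho - sigma * n%:R).
Proof.
by rewrite endo_traceZ endo_traceD -scaleNr endo_traceZ endo_trace_id mulNr.
Qed.

Lemma schouten_sqr x :
  S (S x) = m^-1 ^+ 2 *: (A (A x) - (2 * sigma) *: A x + sigma ^+ 2 *: x).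
Proof.
rewrite 2!schouten_endoE; move: sigma m^-1 => s c.
rewrite linearZ /= scalerA (mulrC s) -(scalerA c s) -scalerBr.
rewrite scalerA -expr2; congr (_ *: _).
rewrite linearB linearZ /= scalerBr scalerA -expr2 opprB addrA addrAC.
by rewrite -[_ - _ - _]addrA -opprD -scalerDl -mulr2n mulr_natl.
Qed.

Lemma schouten_sqr_trace :
  tr (S \o S)%VF = m^-1 ^+ 2 *
    (tr (A \o A)%VF - 2 * sigma * rho + sigma ^+ 2 * n%:R).
Proof.
have -> : sigma ^+ 2 * n%:R = tr (sigma ^+ 2 *: \1)%VF.
  by rewrite endo_traceZ endo_trace_id.
rewrite -mulNr -!endo_traceZ -!endo_traceD -endo_traceZ.
apply: eq_endo_trace => x; rewrite comp_lfunE schouten_sqr.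
by rewrite !(scale_lfunE, add_lfunE, comp_lfunE, id_lfunE) scaleNr.
Qed.

(** Moving [S] across the metric turns the sum into the trace of -1/4 S ad y ad x. Ric commutes with
    brackets, so it is absorbed into [y], and Killing forms remain. *)
Lemma curvature_contract x y :
  \sum_(a < n) curvature_tensor br g e`_a x y (S (d a)) =
  m^-1 * (g (A (A y)) x - sigma * g (A y) x).
Proof.
rewrite !ricciE /ricci_tensor.
have -> : m^-1 * (- 4^-1 * killing br (A y) x
                  - sigma * (- 4^-1 * killing br y x)) =
  - 4^-1 * (m^-1 * (killing br (A y) x - sigma * killing br y x)) by ring.
rewrite /killing -mulNr -!endo_traceZ -endo_traceD -endo_traceZ endo_traceE.
rewrite mulr_sumr; apply: eq_bigr => a _.
rewrite /curvature_tensor /curvature metricZl -schouten_adjoint.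
congr (_ * g _ _).
rewrite schouten_endoE !(scale_lfunE, add_lfunE, comp_lfunE) !adE.
have brCC u v w : br (br u v) w = br w (br v u).
  by rewrite brC (brC u v) linearNr opprK.
by rewrite ricci_br_r !brCC scaleNr.
Qed.

Lemma bach_contract x y :
  bach br g x y =
  m^-1 * (g (A (A y)) x - sigma * g (A y) x)
  + 2 * g (S (S y)) x - tr S * g (S y) x - tr (S \o S)%VF * g y x.
Proof.
rewrite /bach (schouten_up_contract (h := fun u v => weyl br g u x y v));
  last first.
  move=> u a v w; rewrite /weyl !schoutenE /curvature_tensor.
  by rewrite (linearP S) !(metricPr, metricPl) /=; ring.
under eq_bigr do rewrite /weyl !schoutenE.
rewrite !big_split /= curvature_contract !sumrN -!addrA; congr (_ + _).
(* The four metric terms of the Weyl tensor contract, in order, to S^2, tr S times S, S^2 again, and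
   tr (S^2) times the metric. *)
have -> : \sum_(a < n) g e`_a y * g (S (S (d a))) x = g (S (S y)) x.
  rewrite [RHS]schouten_adjoint schouten_adjoint -dual_pairing.
  by apply: eq_bigr => a _; rewrite [in LHS]schouten_adjoint schouten_adjoint.
have -> : \sum_(a < n) g e`_a (S (d a)) * g (S y) x = tr S * g (S y) x.
  rewrite endo_traceE mulr_suml.
  by apply: eq_bigr => a _; rewrite [in RHS]schouten_adjoint.
have -> : \sum_(a < n) g x (S (d a)) * g (S y) e`_a = g (S (S y)) x.
  rewrite [RHS]schouten_adjoint -dual_pairing; apply: eq_bigr => a _.
  by rewrite mulrC (metricC (S y)) (metricC x) schouten_adjoint.
have -> : \sum_(a < n) g x y * g (S (S (d a))) e`_a = tr (S \o S)%VF * g y x.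
  rewrite endo_traceE mulr_suml; apply: eq_bigr => a _.
  by rewrite comp_lfunE !schouten_adjoint mulrC (metricC x) metricC
    -!schouten_adjoint.
by ring.
Qed.

(** The endomorphism of (n-2)^2 B. Since 2 sigma = rho/(n-1) = tau, it is n Q - (tr Q) id with Q =
    Ric^2 - tau Ric. *)
Definition bach_endo : 'End(V) :=
  n%:R *: (A \o A)%VF - (2 * n%:R * sigma) *: A
  - (tr (A \o A)%VF - 2 * sigma * rho) *: \1%VF.

Hypothesis hn : (2 < n)%N.

Let m_neq0 : m != 0.
Proof. by rewrite subr_eq0 -[2]/(2%:R) eqr_nat gtn_eqF. Qed.

Let n1_neq0 : n%:R - 1 != 0 :> R.
Proof. by rewrite subr_eq0 -[1]/(1%:R) eqr_nat gtn_eqF // ltnW. Qed.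

Lemma bachE x y : m ^+ 2 * bach br g x y = g (bach_endo y) x.
Proof.
rewrite bach_contract schouten_sqr_trace schouten_trace_ginv.
rewrite schouten_sqr schouten_endoE /bach_endo.
rewrite !(add_lfunE, opp_lfunE, scale_lfunE, comp_lfunE, id_lfunE).
rewrite !(metricBl, metricZl, metricDl).
(* Eliminating rho in favour of sigma leaves n-2 as the only denominator. *)
have rhoE : rho = 2 * (n%:R - 1) * sigma by field.
move: sigma rhoE => s ->; field; exact: m_neq0.
Qed.

(** * Bach flatness and the Einstein condition as matrix equations *)

Local Notation tau := (rho / (n%:R - 1)).

Lemma mxof_scalar (f : 'End(V)) c : mxof e e f = c%:M <-> f = c *: \1%VF.
Proof.
have scE : mxof e e (c *: \1%VF) = c%:M.
  by rewrite linearZ /= mxof1 ?scalemx1 // (basis_free ebasis).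
split=> [fc|->//]; apply: (can_inj (mxofK ebasis ebasis)).
by rewrite fc scE.
Qed.

Lemma ricci_quadraticE :
  M *m M - tau *: M = mxof e e ((A \o A)%VF - tau *: A).
Proof.
rewrite (linearB (mxof e e)) (linearZ_LR (mxof e e)) /=.
by rewrite (mxof_comp _ _ ebasis).
Qed.

Lemma bach_flatP :
  bach_flat br g <-> exists c, M *m M - tau *: M = c%:M.
Proof.
rewrite ricci_quadraticE.
set Q := (A \o A)%VF - tau *: A; set c0 := tr (A \o A)%VF - 2 * sigma * rho.
have BQ : bach_endo = n%:R *: Q - c0 *: \1%VF.
  have nt : 2 * n%:R * sigma = n%:R * tau by field; exact: n1_neq0.
  rewrite /bach_endo -/c0 /Q nt -(scalerA n%:R tau A).
  by congr (_ - _); rewrite [RHS]scalerBr.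
have n0 : n%:R != 0 :> R by rewrite pnatr_eq0 -lt0n (ltn_trans _ hn).
split=> [B0|[c /mxof_scalar Qc] x y].
  exists (c0 / n%:R); apply/mxof_scalar.
  have /eqP : bach_endo = 0.
    apply/lfunP => y; rewrite zero_lfunE; apply: metric_inj => x.
    by rewrite -bachE B0 mulr0 linear0l.
  rewrite BQ subr_eq0 => /eqP /(congr1 (fun f => n%:R^-1 *: f)).
  by rewrite !scalerA mulVf // scale1r mulrC.
(* Conversely, taking the trace of Q = c id gives c0 = n c, which makes [bach_endo] vanish. *)
have trQ : tr Q = tr (A \o A)%VF - 2 * sigma * rho.
  rewrite /Q endo_traceD -scaleNr endo_traceZ -/rho.
  by field; exact: n1_neq0.
have c0E : c0 = n%:R * c.
  by rewrite /c0 -trQ Qc endo_traceZ endo_trace_id mulrC.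
apply: (mulfI (expf_neq0 2 m_neq0)).
by rewrite bachE BQ Qc c0E scalerA subrr zero_lfunE linear0l mulr0.
Qed.

Lemma einsteinP : einstein br g <-> exists c, M = c%:M.
Proof.
split=> [[c Ec]|[c /mxof_scalar Ac]]; exists c; last first.
  by move=> x y; rewrite -ricciE Ac scale_lfunE id_lfunE metricZl.
apply/mxof_scalar/lfunP => x; rewrite scale_lfunE id_lfunE.
by apply: metric_inj => y; rewrite ricciE Ec metricZl.
Qed.

Lemma ricci_sqr_eq0 : (A \o A)%VF = 0 <-> M *m M = 0.
Proof.
rewrite -(mxof_comp _ _ ebasis); split=> [->|/eqP]; first by rewrite linear0.
by rewrite mxof_eq0 // => /eqP.
Qed.

Lemma ricci_mx_adjoint : M *m gram g = gram g *m M^T.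
Proof.
have ME i j : (M *m gram g) i j = g (A e`_i) e`_j.
  rewrite [A e`_i]basis_expansion metric_suml mxE; apply: eq_bigr => k _.
  by rewrite mxE /= !mxE vecof_delta coord_dual.
rewrite -{2}trmx_gram -trmx_mul; apply/matrixP => i j.
by rewrite [RHS]mxE !ME ricci_adjoint metricC.
Qed.

(** * Eigenvalues of the complexified Ricci matrix *)

Local Notation RiC := (ricciC br g).

Lemma ricci_traceE : \tr M = (n%:R - 1) * tau.
Proof. by rewrite mulrC divfK //; exact: n1_neq0. Qed.

Lemma ricciC_traceE : \tr RiC = (n%:R - 1) * real_complex R tau.
Proof.
rewrite /ricciC trace_map_mx ricci_traceE; move: tau => t.
by rewrite rmorphM rmorphB /= rmorph_nat rmorph1.
Qed.

(** By the rank formula the trace is k lam + (n-k) mu; the relation (k-1) mu = -(n-k-1) lam turns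
    this into the stated value. *)
Lemma ricciC_trace_two lam mu (k : nat) :
  lam != mu -> (2 <= k)%N -> \rank (eigenspace RiC lam) = k ->
  mu = - ((n%:R - k%:R - 1) / (k%:R - 1)) * lam ->
  (RiC - lam%:M) *m (RiC - mu%:M) = 0 ->
  \tr RiC = (n%:R - 1) * (lam + mu).
Proof.
move=> lm k2 rk muE /(rank_eigenspace_two lm); rewrite rk => /eqP.
rewrite eq_sym subr_eq => /eqP ->.
have k1 : k%:R - 1 != 0 :> R[i].
  by rewrite subr_eq0 -[1]/(1%:R) eqr_nat gtn_eqF.
by rewrite muE; field; exact: k1.
Qed.

Lemma two_eigenvalues_quadratic :
  ricci_two_eigenvalues br g -> exists c, M *m M - tau *: M = c%:M.
Proof.
move=> [lam [mu [k [[lm _ k2 rk] muE diagN eigN _]]]].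
have annN : (RiC - lam%:M) *m (RiC - mu%:M) = 0.
  by apply: diagonalizable_two_ann diagN _ => x; rewrite eigN.
have trN := ricciC_trace_two lm k2 rk muE annN.
have n1C : n%:R - 1 != 0 :> R[i].
  by rewrite subr_eq0 -[1]/(1%:R) eqr_nat gtn_eqF // ltnW.
have tauE : real_complex R tau = lam + mu.
  by apply: (mulfI n1C); rewrite -trN ricciC_traceE.
(* Over the complex numbers the scalar is -(lam mu); descent shows that it comes from a real one,
   even for complex roots. *)
apply: (@map_mx_scalar_inv _ _ (real_complex R) _ _ (- (lam * mu))) => //.
  by rewrite (ltn_trans _ hn).
rewrite map_mxB map_mxM map_mxZ -/RiC.
rewrite [X in X *: _](_ : _ = lam + mu); last exact: tauE.
apply/eqP; rewrite -subr_eq0 -annN mulmxBl !mulmxBr !mul_mx_scalar.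
rewrite !mul_scalar_mx scale_scalar_mx rmorphN /= scalerDl.
by apply/eqP/matrixP => i j; rewrite !mxE; ring.
Qed.

Lemma quadratic_ricci_cases c :
  M *m M - tau *: M = c%:M ->
  [\/ exists a, M = a%:M, M *m M = 0 | ricci_two_eigenvalues br g].
Proof.
move=> /(congr1 (map_mx (real_complex R))).
rewrite map_mxB map_mxM map_mxZ map_scalar_mx -/RiC => quadN.
have [[a Na]|NN|] := quadratic_trace_cases hn ricciC_traceE quadN.
- by apply: Or31; apply: map_mx_scalar_inv Na; rewrite (ltn_trans _ hn).
- apply: Or32; apply/eqP.
  by rewrite -(map_mx_eq0 (real_complex R)) map_mxM; apply/eqP.
move=> [lam [mu [[lm lam0 annN Elam Emu] trNlm]]]; apply: Or33.
have [k2 muE] := two_roots_multiplicity hn lm annN trNlm lam0 Elam.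
have mulam : mu != lam by rewrite eq_sym.
have NG : RiC *m gramC g = gramC g *m RiC^T.
  by rewrite /ricciC /gramC map_trmx -!map_mxM ricci_mx_adjoint.
have Gfree : row_free (gramC g) by rewrite row_free_map gram_row_free.
exists lam, mu, (\rank (eigenspace RiC lam)); split=> //.
- exact: (diagonalizable_two lm annN).
- move=> x; apply/idP/idP; first exact: (eigenvalue_two annN).
  by case/orP => /eqP->; [exact: Elam | exact: Emu].
split; first exact: (nondegenerate_eigenspace_two lm annN NG Gfree).
have annN' := quadratic_annihilatorC annN.
exact: (nondegenerate_eigenspace_two mulam annN' NG Gfree).
Qed.

(** * The kernel of the Ricci endomorphism *)

Lemma eigenspace_ricciC0 : eigenspace RiC 0 = map_mx (real_complex R) (kermx M).
Proof. by rewrite map_kermx /eigenspace raddf0 subr0. Qed.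

Lemma mem_lker_ricci x : (x \in lker A) = (rVof e x <= kermx M)%MS.
Proof. by rewrite (lker_ker ebasis) -rVof_sub. Qed.

Lemma dim_lker_ricci1 : \rank (kermx M) = 1%N -> lker A != 0%VS ->
  \dim (lker A) = 1%N.
Proof.
move=> rk1 A0; set v := vpick (lker A).
have v0 : v != 0 by rewrite vpick0.
have vK : (rVof e v <= kermx M)%MS by rewrite -mem_lker_ricci memv_pick.
suff -> : lker A = <[v]>%VS by rewrite dim_vline v0.
apply/vspaceP => w; apply/idP/vlineP => [|[a ->]]; last first.
  by rewrite rpredZ ?memv_pick.
rewrite mem_lker_ricci => wK.
have /sub_rVP[a wa] : (rVof e w <= rVof e v)%MS.
  apply: submx_trans wK _.
  rewrite -(geq_leqif (mxrank_leqif_sup vK)) rk1 rank_rV rVof_eq0 //.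
  by rewrite v0.
by exists a; apply: (can_inj (rVofK ebasis)); rewrite wa linearZ.
Qed.

(** The complex kernel is spanned by the real one, so a real kernel vector orthogonal to the real
    kernel is also orthogonal to the complex one. *)
Lemma nondegenerate_lker_ricci :
  nondegenerateC g (eigenspace RiC 0) -> nondegenerate_subspace g (lker A).
Proof.
move=> nd; apply/eqP; rewrite -subv0; apply/subvP => w.
rewrite memv_cap memv0 mem_lker_ricci => /andP[wK /mem_orthovP worth].
rewrite -(rVof_eq0 ebasis) -(map_mx_eq0 (real_complex R)) -submx0.
rewrite -nd sub_capmx eigenspace_ricciC0 map_submx wK /=.
apply/sub_kermxP; rewrite map_mx_id // map_trmx -!map_mxM.
suff -> : rVof e w *m (gram g *m (kermx M)^T) = 0 by rewrite map_mx0.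
apply/rowP => i; rewrite [RHS]mxE -[RHS](worth (vecof e (row i (kermx M)))).
  rewrite -{2}(rVofK ebasis w) metric_vecof mulmxA mxE [RHS]mxE.
  by apply: eq_bigr => j _; rewrite !mxE.
by rewrite mem_lker_ricci (vecofK ebasis) row_sub.
Qed.

Lemma two_eigenvalues_lker :
  ricci_two_eigenvalues br g -> lker A <> 0%VS ->
  \dim (lker A) = 1%N /\ nondegenerate_subspace g (lker A).
Proof.
move=> [lam [mu [k [[lm lam0 k2 rk] muE diagN eigN [_ ndmu]]]]] /eqP A0.
have annN : (RiC - lam%:M) *m (RiC - mu%:M) = 0.
  by apply: diagonalizable_two_ann diagN _ => x; rewrite eigN.
have trN := ricciC_trace_two lm k2 rk muE annN.
have E0 : eigenspace RiC 0 != 0.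
  rewrite eigenspace_ricciC0 map_mx_eq0; apply: contraNneq A0 => K0.
  by rewrite (lker_ker ebasis) K0 (vsof0 ebasis).
(* Zero is an eigenvalue and [lam] is nonzero. *)
have mu0 : mu = 0.
  by have := eigN 0; rewrite [LHS]E0 ![0 == _]eq_sym (negPf lam0) => /esym/eqP.
have rk1 : \rank (kermx M) = 1%N.
  rewrite -(mxrank_map (real_complex R)) -eigenspace_ricciC0 -mu0.
  have mulam : mu != lam by rewrite eq_sym.
  (* With the roots exchanged and mu = 0, the rank formula gives rank * (-lam) = (n-1) lam - n lam =
     -lam. *)
  have := rank_eigenspace_two mulam (quadratic_annihilatorC annN).
  rewrite trN mu0 => rkmu.
  apply/eqP; rewrite -(eqr_nat R[i]); apply/eqP/(mulIf lam0)/oppr_inj.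
  by transitivity ((\rank (eigenspace RiC 0))%:R * (0 - lam));
    [ring | rewrite rkmu; ring].
split; first exact: dim_lker_ricci1.
by apply: nondegenerate_lker_ricci; rewrite -mu0.
Qed.

End MetricLie.

Theorem theorem1p2 (R : realType) (V : vectType R)
    (br : {bilinear V -> V -> V}) (g : {symmetric V})
    (hg : metric_lie_algebra br g) (hn : (2 < \dim {:V})%N) :
  (bach_flat br g <->
     einstein br g \/
     (ricci br g \o ricci br g)%VF = 0 \/
     ricci_two_eigenvalues br g) /\
  (ricci_two_eigenvalues br g ->
     lker (ricci br g) <> 0%VS ->
     \dim (lker (ricci br g)) = 1%N /\
     nondegenerate_subspace g (lker (ricci br g))).
Proof.
split.
  rewrite (bach_flatP hg hn) (einsteinP hg) ricci_sqr_eq0; split.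
    by case=> c /(quadratic_ricci_cases hg hn)[];
      [left | right; left | right; right].
  case=> [[c Mc]|[MM|]]; last exact: two_eigenvalues_quadratic.
    exists (c ^+ 2 - scalar_curvature br g / ((\dim {:V})%:R - 1) * c).
    by rewrite Mc -scalar_mxM scale_scalar_mx raddfB.
  (* Ric^2 = 0 forces tr Ric = 0, so tau = 0 and the scalar is 0. *)
  exists 0; rewrite MM /scalar_curvature /endo_trace.
  rewrite (@mxtrace_quasi_idempotent _ _ _ 0) ?scale0r //.
  by rewrite !mul0r scale0r subr0 raddf0.
exact: two_eigenvalues_lker.
Qed.
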